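(* Let $N$ be a Nijenhuis operator on an associative conformal algebra $(\mathcal{A},\theta_\lambda)$, where $\theta_\lambda(a,b)=a_\lambda b$. Then for all $a,b\in\mathcal{A}$ and all $i,k=0,1,2,\dots$, $$N^k(a)\circ^{N^i}_\lambda b+a\circ^{N^i}_\lambda N^k(b)-N^k(a\circ^{N^i}_\lambda b)=a\circ^{N^{i+k}}_\lambda b,$$ and $N^k$ is a Nijenhuis operator on $(\mathcal{A},\theta^{N^i}_\lambda)$. In particular, all the $\lambda$-products $\theta^{N^k}_\lambda$, $k=0,1,2,\dots$, are associative and compatible with each other.
   Context: All vector spaces are over $\mathbb{C}$. A $\lambda$-product on a $\mathbb{C}[\partial]$-module $\mathcal{A}$ is a $\mathbb{C}$-bilinear map $\mathcal{A}\times\mathcal{A}\to\mathcal{A}[\lambda]$, $(a,b)\mapsto a_\lambda b$, with $(\partial a)_\lambda b=-\lambda\,a_\lambda b$ and $a_\lambda(\partial b)=(\partial+\lambda)(a_\lambda b)$; it is associative, and $\mathcal{A}$ with it is an associative conformal algebra, if $(a_\lambda b)_{\lambda+\mu}c=a_\lambda(b_\mu c)$ for all $a,b,c$. Maps are extended coefficientwise to polynomials. A Nijenhuis operator on an associative conformal algebra is a $\mathbb{C}[\partial]$-module endomorphism $N$ with $N(a)_\lambda N(b)=N\big(N(a)_\lambda b+a_\lambda N(b)-N(a_\lambda b)\big)$ for all $a,b$. For a $\mathbb{C}[\partial]$-module endomorphism $P$ of $\mathcal{A}$, $\theta^P_\lambda(a,b)=a\circ^P_\lambda b:=P(a)_\lambda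 b+a_\lambda P(b)-P(a_\lambda b)$, where $a_\lambda b$ is the original $\lambda$-product. ''$N^k$ is a Nijenhuis operator on $(\mathcal{A},\theta^{N^i}_\lambda)$'' means the Nijenhuis identity for $N^k$ with respect to the product $\circ^{N^i}_\lambda$. Two associative $\lambda$-products $\theta^1_\lambda,\theta^2_\lambda$ on $\mathcal{A}$ are compatible if $\theta^1_\lambda+q\theta^2_\lambda$ is associative for all $q\in\mathbb{C}$. *)

(* Defs.v *)
From HB Require Import structures.
From mathcomp Require Import all_boot all_order all_algebra.
From mathcomp Require Import complex reals.
From mathcomp Require Import finmap monalg.

Set Implicit Arguments.
Unset Strict Implicit.
Unset Printing Implicit Defensive.

Import GRing.Theory.

Local Open Scope ring_scope.
Local Open Scope complex_scope.

(* A C[∂]-module is an [lmodType {poly R[i]}]: ∂ acts as ['X *: _] and a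
   scalar c of C = R[i] acts as [c%:P *: _].
   A[λ] is the group of finitely supported families of elements of A indexed by
   nat: [p@_n] is the coefficient of λ^n, and [<< x *g n >>] is x λ^n.
   In A[λ,μ], [<< x *g (m, n) >>] is x λ^m μ^n. *)
Notation lpoly A := {malg A[nat]}.
Notation lmpoly A := {malg A[(nat * nat)%type]}.

Section Conformal.
Variables (R : realType) (A : lmodType {poly R[i]}).
Implicit Types (theta : A -> A -> lpoly A) (P N : A -> A).

(* Coefficientwise extension; meaningful for f 0 = 0, as for all linear f. *)
Definition coefmap (f : A -> A) (p : lpoly A) : lpoly A :=
  \sum_(n <- msupp p) << f p@_n *g n >>.

Definition del (x : A) : A := 'X *: x.

Definition scaleC (c : R[i]) (p : lpoly A) : lpoly A :=
  coefmap (fun x => c%:P *: x) p.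

Definition mulLambda (p : lpoly A) : lpoly A :=
  \sum_(n <- msupp p) << p@_n *g n.+1 >>.

Definition lambda_product theta : Prop :=
  [/\ forall (c : R[i]) a a' b,
        theta (c%:P *: a + a') b = scaleC c (theta a b) + theta a' b,
      forall (c : R[i]) a b b',
        theta a (c%:P *: b + b') = scaleC c (theta a b) + theta a b',
      forall a b, theta (del a) b = - mulLambda (theta a b)
    & forall a b,
        theta a (del b) = coefmap del (theta a b) + mulLambda (theta a b)].

(* λ^m p(λ + μ), by the binomial theorem. *)
Definition shift_lambda_mu (m : nat) (p : lpoly A) : lmpoly A :=
  \sum_(n <- msupp p) \sum_(l < n.+1)
    << p@_n *+ 'C(n, l) *g ((m + l)%N, (n - l)%N) >>.

(* (a_λ b)_{λ+μ} c: if a_λ b = Σ_m x_m λ^m, this is Σ_m λ^m (x_m)_{λ+μ} c. *)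
Definition lprod_lassoc theta (a b c : A) : lmpoly A :=
  \sum_(m <- msupp (theta a b)) shift_lambda_mu m (theta (theta a b)@_m c).

(* a_λ (b_μ c): if b_μ c = Σ_n y_n μ^n, this is Σ_n μ^n (a_λ y_n). *)
Definition lprod_rassoc theta (a b c : A) : lmpoly A :=
  \sum_(n <- msupp (theta b c))
    \sum_(m <- msupp (theta a (theta b c)@_n))
      << (theta a (theta b c)@_n)@_m *g (m, n) >>.

Definition assoc_lambda_product theta : Prop :=
  lambda_product theta /\
  forall a b c, lprod_lassoc theta a b c = lprod_rassoc theta a b c.

(* [linear N] is linearity over {poly R[i]} = C[∂]. *)
Definition Nijenhuis theta N : Prop :=
  linear N /\
  forall a b,
    theta (N a) (N b) =
    coefmap N (theta (N a) b + theta a (N b) - coefmap N (theta a b)).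

Definition deformed theta P : A -> A -> lpoly A := fun a b =>
  theta (P a) b + theta a (P b) - coefmap P (theta a b).

Definition compatible (theta1 theta2 : A -> A -> lpoly A) : Prop :=
  forall q : R[i],
    assoc_lambda_product (fun a b => theta1 a b + scaleC q (theta2 a b)).

End Conformal.

(* Main.v *)
(* Let L_P, R_P act on bilinear maps by precomposing an argument with P, and let
   P act by postcomposition. These actions commute for powers of N; the deformed
   product is (L_P + R_P - P) theta, and N is Nijenhuis iff
   (L_N - N)(R_N - N) theta = 0. As L_f - f is a multiple of L_N - N for every
   polynomial f in N, the identity polarizes to (L_f - f)(R_g - g) theta = 0,
   which gives the first two claims by expansion. Moreover N^k + q N^l is itself
   a Nijenhuis operator and its deformed product is
   theta^{N^k} + q theta^{N^l}; so compatibility reduces to the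
   associativity of theta^P for P Nijenhuis. *)
Require Import Defs.
From mathcomp Require Import all_boot all_order all_algebra.
From mathcomp Require Import complex reals.
From mathcomp Require Import finmap monalg.
From HB Require Import structures.
From mathcomp Require Import boolp ssrAC.

Import GRing.Theory.

Local Open Scope ring_scope.
Local Open Scope complex_scope.

Set Implicit Arguments.
Unset Strict Implicit.
Unset Printing Implicit Defensive.

(** * Rearrangements of sums in abelian groups *)

Lemma addrB_exchange (V : zmodType) (x y z x' y' z' : V) :
  (x + x') + (y + y') - (z + z') = (x + y - z) + (x' + y' - z').
Proof. by rewrite opprD !addrA [LHS](ACl (1*3*5*2*4*6)). Qed.

Lemma addr_transpose (V : zmodType) (x y z x' y' z' x'' y'' z'' : V) :
  (x + y + z) + (x' + y' + z') + (x'' + y'' + z'') =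
  (x + x' + x'') + (y + y' + y'') + (z + z' + z'').
Proof. by rewrite [LHS](AC (3*3*3) ((1*4*7)*(2*5*8)*(3*6*9))). Qed.

Lemma addrB_cancelr (V : zmodType) (x y z t : V) :
  x + (y + z - t) - y = x + z - t.
Proof. by rewrite !addrA [LHS](ACl (1*3*4*(2*5))) /= subrr addr0. Qed.

Lemma addrB_cancell (V : zmodType) (x y z t : V) :
  x + y - t + z - y = x + z - t.
Proof. by rewrite [LHS](ACl (1*4*3*(2*5))) /= subrr addr0. Qed.

Lemma addrB_cancel (V : zmodType) (x y z t u v w1 w2 : V) :
  (x + (w1 + y - z) - w1) + (t + w2 - v + u - w2) - (t + y - z) = x + u - v.
Proof.
rewrite addrB_cancelr addrB_cancell opprB opprD !addrA.
by rewrite [LHS](ACl (1*5*6*(2*9)*(4*8)*(7*3))) /= !subrr !addr0.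
Qed.

Lemma addr_rev (V : zmodType) (x y z : V) : x + y + z = z + y + x.
Proof. by rewrite addrC [x + y]addrC addrA. Qed.

Lemma addr_rev2 (V : zmodType) (f : V -> V) (x y z t u v w : V) :
  x + y + z - f (t + u + v) + w = z + y + x - f (v + u + t) + w.
Proof. by rewrite (addr_rev x) (addr_rev t). Qed.

(** * Additive sums over the coefficients of finitely supported families *)

Section CoefficientwiseSums.
Variables (K : choiceType) (G H : zmodType).

(** [coefmap], [mulLambda], [shift_lambda_mu] and both sides of associativity are convertible to
    instances of this sum, so additivity is proved only once. *)
Definition malg_sum (F : K -> G -> H) (p : {malg G[K]}) : H :=
  \sum_(k <- msupp p) F k p@_k.

Section Additive.
Variable F : K -> {additive G -> H}.

(** An additive [F k] kills the coefficients outside the support. Enlarging the index set lets [p],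
    [q] and [p - q] be summed over one common set. *)
Lemma malg_sumEw (d : {fset K}) (p : {malg G[K]}) : (msupp p `<=` d)%fset ->
  malg_sum F p = \sum_(k <- d) F k p@_k.
Proof.
move=> le_pd; rewrite [LHS](big_fset_incl _ le_pd) => //= k _ /mcoeff_outdom ->.
by rewrite raddf0.
Qed.

Lemma malg_sum_is_zmod_morphism : zmod_morphism (malg_sum F).
Proof.
move=> p q; rewrite (malg_sumEw (d := (msupp p `|` msupp q)%fset)) ?msuppB_le //.
rewrite (malg_sumEw (p := p) (d := (msupp p `|` msupp q)%fset)) ?fsubsetUl //.
rewrite (malg_sumEw (p := q) (d := (msupp p `|` msupp q)%fset)) ?fsubsetUr //.
by rewrite -sumrB; apply/eq_bigr => k _; rewrite mcoeffB raddfB.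
Qed.

HB.instance Definition _ :=
  GRing.isZmodMorphism.Build {malg G[K]} H (malg_sum F)
    malg_sum_is_zmod_morphism.

Lemma malg_sumU x k : malg_sum F << x *g k >> = F k x.
Proof. by rewrite (malg_sumEw msuppU_le) big_seq_fset1 mcoeffUU. Qed.

End Additive.
End CoefficientwiseSums.

Section CoefficientwiseMap.
Variables (K : choiceType) (G : zmodType).

(** [coefmap] for an arbitrary index type, since P must also act on A[λ,μ]. *)
Definition malg_map (f : G -> G) : {malg G[K]} -> {malg G[K]} :=
  malg_sum (fun k x => << f x *g k >>).

HB.instance Definition _ (f : {additive G -> G}) :=
  GRing.Additive.copy (malg_map f) (malg_sum (fun k => mkmalgU k \o f)).

Lemma malg_mapU (f : {additive G -> G}) x k :
  malg_map f << x *g k >> = << f x *g k >>.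
Proof. exact: (malg_sumU (fun k => mkmalgU k \o f)). Qed.

Lemma mcoeff_map (f : {additive G -> G}) p k : (malg_map f p)@_k = f p@_k.
Proof.
rewrite /malg_map /malg_sum [in RHS](monalgE p) !raddf_sum.
by apply: eq_bigr => j _; rewrite /= !mcoeffU raddfMn.
Qed.

Lemma malg_sum_map (H : zmodType) (F : K -> {additive G -> H})
    (f : {additive G -> G}) p :
  malg_sum F (malg_map f p) = malg_sum (fun k x => F k (f x)) p.
Proof.
by rewrite [LHS]raddf_sum; apply: eq_bigr => k _; exact: malg_sumU.
Qed.

End CoefficientwiseMap.

(** * Additivity of the operations on A[λ] and their commutation with linear maps *)

Section Conformal.
Variables (R : realType) (A : lmodType {poly R[i]}).
Implicit Types (f g h P N : {linear A -> A}) (theta : A -> A -> lpoly A).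

HB.instance Definition _ (f : {additive A -> A}) :=
  GRing.Additive.copy (coefmap f) (malg_map f : lpoly A -> lpoly A).

HB.instance Definition _ := GRing.Linear.copy (@del R A) ( *:%R 'X).

Lemma mcoeff_coefmap (f : {additive A -> A}) p n : (coefmap f p)@_n = f p@_n.
Proof. exact: mcoeff_map. Qed.

HB.instance Definition _ c :=
  GRing.Additive.copy (@scaleC R A c) (coefmap ( *:%R c%:P)).

Lemma mcoeff_scaleC c (p : lpoly A) n : (scaleC c p)@_n = c%:P *: p@_n.
Proof. exact: (mcoeff_coefmap ( *:%R c%:P)). Qed.

HB.instance Definition _ :=
  GRing.Additive.copy (@mulLambda R A) (malg_sum (fun n => mkmalgU n.+1)).

Lemma coefmap_scaleC f c p : coefmap f (scaleC c p) = scaleC c (coefmap f p).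
Proof.
by apply/malgP => n; rewrite !(mcoeff_coefmap, mcoeff_scaleC); exact: linearZ.
Qed.

Lemma coefmap_del f p :
  coefmap f (coefmap (@del R A) p) = coefmap (@del R A) (coefmap f p).
Proof.
by apply/malgP => n; rewrite !mcoeff_coefmap /=; exact: linearZ.
Qed.

Lemma coefmap_mulLambda f (p : lpoly A) :
  coefmap f (mulLambda p) = mulLambda (coefmap f p).
Proof.
rewrite raddf_sum [RHS](malg_sum_map (fun n => mkmalgU n.+1)).
by apply: eq_bigr => n _; exact: malg_mapU.
Qed.

Definition biadditive theta : Prop :=
  (forall b, zmod_morphism (theta^~ b)) /\ (forall a, zmod_morphism (theta a)).

(** * Triple products of a deformed product *)

Section Composition.
Variables (S : nat -> {additive lpoly A -> lmpoly A}) (theta : A -> A -> lpoly A).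
Hypothesis theta_biadd : biadditive theta.

(* With [S m q] = λ^m q(λ + μ) this computes p_{λ+μ} c; with [S n q] = μ^n q and
   theta flipped it computes c_λ p for p in A[μ]. Both sides of associativity are
   instances, so one expansion serves for both. *)
Definition extend (phi : A -> A -> lpoly A) (p : lpoly A) (c : A) : lmpoly A :=
  malg_sum (fun m x => S m (phi x c)) p.

Lemma extendB c : zmod_morphism (extend theta ^~ c).
Proof.
pose tc : {additive A -> lpoly A} :=
  HB.pack (theta^~ c) (GRing.isZmodMorphism.Build _ _ _ (theta_biadd.1 c)).
exact: (@malg_sum_is_zmod_morphism _ _ _ (fun m => S m \o tc)).
Qed.

Lemma extend_coefmap (f : {additive A -> A}) phi p c : biadditive phi ->
  extend phi (coefmap f p) c = extend (fun x => phi (f x)) p c.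
Proof.
move=> phi_biadd; pose tc : {additive A -> lpoly A} :=
  HB.pack (phi^~ c) (GRing.isZmodMorphism.Build _ _ _ (phi_biadd.1 c)).
exact: (malg_sum_map (fun m => S m \o tc)).
Qed.

Variable P : {linear A -> A}.
Hypothesis S_coefmap : forall m p, S m (coefmap P p) = malg_map P (S m p).

Lemma extend_deformed p c :
  extend (deformed theta P) p c =
  extend theta (coefmap P p) c + extend theta p (P c)
    - malg_map P (extend theta p c).
Proof.
rewrite extend_coefmap // [malg_map P _]raddf_sum -big_split -sumrB.
by apply: eq_bigr => m _; rewrite raddfB raddfD S_coefmap.
Qed.

Hypothesis P_Nijenhuis : Nijenhuis theta P.

Lemma extend_Nijenhuis p c :
  extend theta (coefmap P p) (P c) = malg_map P (extend (deformed theta P) p c).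
Proof.
rewrite extend_coefmap // [RHS]raddf_sum; apply: eq_bigr => m _.
by rewrite P_Nijenhuis.2 S_coefmap.
Qed.

(** Write ∘ for the deformed product. In (a∘b)∘c = P(a∘b)c + (a∘b)P(c) - P((a∘b)c), the first term
    is (P(a)P(b))c, and the part -P(ab)P(c) of the second is expanded by the Nijenhuis identity.
    What remains are undeformed triple products with two, one or no arguments under P, a shape
    preserved by reversing the arguments. *)
Lemma extend_deformed2 a b c :
  extend (deformed theta P) (deformed theta P a b) c =
  extend theta (theta (P a) (P b)) c + extend theta (theta (P a) b) (P c)
    + extend theta (theta a (P b)) (P c)
    - malg_map P (extend theta (theta (P a) b) c + extend theta (theta a (P b)) c
        + extend theta (theta a b) (P c))
    + malg_map P (malg_map P (extend theta (theta a b) c)).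
Proof.
have extendDB d p q r :
    extend theta (p + q - r) d =
    extend theta p d + extend theta q d - extend theta r d.
  pose ed : {additive lpoly A -> lmpoly A} :=
    HB.pack (extend theta^~ d) (GRing.isZmodMorphism.Build _ _ _ (extendB d)).
  by rewrite [LHS](raddfB ed) [ed _](raddfD ed).
rewrite extend_deformed -(P_Nijenhuis.2 a b) /deformed !extendDB.
rewrite extend_Nijenhuis extend_deformed !(raddfB, raddfD) /=.
(* Summands 4 and 9 are -P(P(ab)c) and P(P(ab)c). *)
rewrite !opprK !addrA [LHS](ACl (1*2*3*7*8*5*6*(4*9))) /=.
by rewrite addNr addr0.
Qed.

End Composition.

(** * Substitution of λ + μ and multiplication by powers of μ *)

Definition shift_monomial (m n : nat) (x : A) : lmpoly A :=
  \sum_(l < n.+1) << x *+ 'C(n, l) *g ((m + l)%N, (n - l)%N) >>.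

Lemma shift_monomial_is_zmod_morphism m n : zmod_morphism (shift_monomial m n).
Proof.
by move=> x y; rewrite -sumrB; apply: eq_bigr => l _; rewrite mulrnBl raddfB.
Qed.

HB.instance Definition _ m n :=
  GRing.isZmodMorphism.Build A (lmpoly A) (shift_monomial m n)
    (shift_monomial_is_zmod_morphism m n).

HB.instance Definition _ m :=
  GRing.Additive.copy (@shift_lambda_mu R A m)
    (malg_sum (fun n => shift_monomial m n)).

(** The substitution moves coefficients only through integer multiples, which additive maps
    respect. *)
Lemma shift_coefmap f m p :
  shift_lambda_mu m (coefmap f p) = malg_map f (shift_lambda_mu m p).
Proof.
rewrite [LHS](malg_sum_map (fun n => shift_monomial m n)) [RHS]raddf_sum.
apply: eq_bigr => n _; rewrite raddf_sum; apply: eq_bigr => l _.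
by rewrite -raddfMn; exact/esym/malg_mapU.
Qed.

(** p(λ) μ^n, the inner sum of [lprod_rassoc]. *)
Definition place_mu (n : nat) (p : lpoly A) : lmpoly A :=
  malg_sum (fun m x => << x *g (m, n) >>) p.

HB.instance Definition _ n :=
  GRing.Additive.copy (place_mu n) (malg_sum (fun m => mkmalgU (m, n))).

Lemma place_mu_coefmap f n p :
  place_mu n (coefmap f p) = malg_map f (place_mu n p).
Proof.
rewrite [LHS](malg_sum_map (fun m => mkmalgU (m, n))) [RHS]raddf_sum.
by apply: eq_bigr => m _; exact/esym/malg_mapU.
Qed.

(** * Associativity of the product deformed by a Nijenhuis operator *)

Lemma lambda_product_biadditive theta : lambda_product theta -> biadditive theta.
Proof.
have scale1 (p : lpoly A) : scaleC 1 p = p.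
  by apply/malgP => n; rewrite mcoeff_scaleC polyC1 scale1r.
case=> theta_l theta_r _ _; split=> [b|a] x y /=; apply/esym/eqP; rewrite subr_eq.
  by rewrite -[theta (x - y) b]scale1 -theta_l polyC1 scale1r subrK.
by rewrite -[theta a (x - y)]scale1 -theta_r polyC1 scale1r subrK.
Qed.

Lemma lambda_product_deformed theta P :
  lambda_product theta -> lambda_product (deformed theta P).
Proof.
have P_del x : P (del x) = del (P x) by exact: linearZ.
case=> theta_l theta_r theta_dl theta_dr; split=> [c a a' b|c a b b'|a b|a b].
- rewrite /deformed linearP !theta_l [coefmap P _]raddfD /= coefmap_scaleC.
  by rewrite addrB_exchange !raddfB !raddfD.
- rewrite /deformed linearP !theta_r [coefmap P _]raddfD /= coefmap_scaleC.
  by rewrite addrB_exchange !raddfB !raddfD.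
- rewrite /deformed P_del !theta_dl [coefmap P _]raddfN /= coefmap_mulLambda.
  by rewrite !raddfB !raddfD.
rewrite /deformed P_del !theta_dr [coefmap P _]raddfD /= coefmap_del.
by rewrite coefmap_mulLambda addrB_exchange !raddfB !raddfD.
Qed.

Lemma deformed_flip theta P a b :
  deformed (fun x y => theta y x) P a b = deformed theta P b a.
Proof. by rewrite /deformed [theta b _ + _]addrC. Qed.

(** The Nijenhuis identity is invariant under exchanging the arguments, so [extend_deformed2]
    expands the right-nested product too, via the flipped [theta]. The two expansions agree term by
    term by associativity of [theta]. *)
Lemma assoc_deformed theta P : assoc_lambda_product theta ->
  Nijenhuis theta P -> assoc_lambda_product (deformed theta P).
Proof.
case=> theta_lprod theta_assoc nijP.
split=> [|a b c]; first exact: lambda_product_deformed.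
have [theta_l theta_r] := lambda_product_biadditive theta_lprod.
pose flip := fun x y => theta y x.
have nij_flip : Nijenhuis flip P.
  by split=> [|x y]; [exact: nijP.1 | rewrite /flip nijP.2 [theta _ x + _]addrC].
have lassocE x y z :
    lprod_lassoc theta x y z = extend (@shift_lambda_mu R A) theta (theta x y) z.
  by [].
have rassocE x y z :
    lprod_rassoc theta x y z = extend place_mu flip (flip z y) x.
  by [].
have L := @extend_deformed2 (fun m => shift_lambda_mu m) theta
  (conj theta_l theta_r) P (shift_coefmap P) nijP a b c.
have L' := @extend_deformed2 (fun n => place_mu n) flip
  (conj theta_r theta_l) P (place_mu_coefmap P) nij_flip c b a.
apply: (etrans L).
transitivity (extend place_mu (deformed flip P) (deformed flip P c b) a); last first.
  rewrite deformed_flip; apply: eq_bigr => n _.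
  by congr (place_mu _ _); exact: deformed_flip.
apply/esym/(etrans L').
(* The flipped expansion, taken at c, b, a, lists its summands in reverse order. *)
rewrite -!lassocE -!rassocE !theta_assoc.
exact: (addr_rev2 (malg_map P)).
Qed.

(** * The polarized Nijenhuis identity *)

(* (L_f - f)(R_g - g) theta = 0 *)
Definition Nijenhuis_pair theta (f g : A -> A) : Prop := forall a b,
  theta (f a) (g b) =
    coefmap g (theta (f a) b) + coefmap f (theta a (g b))
      - coefmap f (coefmap g (theta a b)).

Lemma Nijenhuis_pairP theta N :
  Nijenhuis theta N <-> Nijenhuis_pair theta N N.
Proof.
have E a b :
    coefmap N (theta (N a) b + theta a (N b) - coefmap N (theta a b)) =
    coefmap N (theta (N a) b) + coefmap N (theta a (N b))
      - coefmap N (coefmap N (theta a b)) by rewrite raddfB raddfD.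
split=> [[_ nijN] a b|nijN]; first by rewrite nijN E.
by split=> [c u v|a b]; [rewrite linearP | rewrite nijN E].
Qed.

Lemma coefmap_id (p : lpoly A) : coefmap idfun p = p.
Proof. by apply/malgP => n; rewrite mcoeff_coefmap. Qed.

Lemma coefmap_comp (f g : {additive A -> A}) (p : lpoly A) :
  coefmap (f \o g) p = coefmap f (coefmap g p).
Proof. by apply/malgP => n; rewrite !mcoeff_coefmap. Qed.

Lemma coefmapC (f g : {additive A -> A}) : f \o g =1 g \o f ->
  forall p, coefmap f (coefmap g p) = coefmap g (coefmap f p).
Proof. by move=> fg p; apply/malgP => n; rewrite !mcoeff_coefmap; exact: fg. Qed.

Lemma Nijenhuis_pair_idl theta g : Nijenhuis_pair theta idfun g.
Proof. by move=> a b; rewrite !coefmap_id addrAC subrr add0r. Qed.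

Lemma Nijenhuis_pair_idr theta f : Nijenhuis_pair theta f idfun.
Proof. by move=> a b; rewrite !coefmap_id addrK. Qed.

(** L_{f1 f2} - f1 f2 = L_{f2} (L_{f1} - f1) + f1 (L_{f2} - f2). *)
Lemma Nijenhuis_pair_compl theta f1 f2 g :
  Nijenhuis_pair theta f1 g -> Nijenhuis_pair theta f2 g ->
  Nijenhuis_pair theta (f1 \o f2) g.
Proof.
move=> nij1 nij2 a b; rewrite /= nij1 nij2 raddfB raddfD /= !coefmap_comp.
exact: addrB_cancelr.
Qed.

(** The analogous splitting of R_{g1 g2} - g1 g2; here L_f - f has to be moved past g1, whence the
    commutation hypothesis. *)
Lemma Nijenhuis_pair_compr theta f g1 g2 : f \o g1 =1 g1 \o f ->
  Nijenhuis_pair theta f g1 -> Nijenhuis_pair theta f g2 ->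
  Nijenhuis_pair theta f (g1 \o g2).
Proof.
move=> fg nij1 nij2 a b; rewrite /= nij1 nij2 raddfB raddfD /= !coefmap_comp.
by rewrite !(coefmapC fg); exact: addrB_cancell.
Qed.

(** L_f + R_f - f commutes with (L_g - g)(R_h - h), so the vanishing for [theta] passes to the
    deformed product. *)
Lemma Nijenhuis_pair_deformed theta f g h :
    f \o g =1 g \o f -> f \o h =1 h \o f ->
  Nijenhuis_pair theta g h -> Nijenhuis_pair (deformed theta f) g h.
Proof.
move=> fg fh nij a b; rewrite /deformed [f (g a)]fg [f (h b)]fh /= !nij.
rewrite !(raddfB, raddfD) /= !(coefmapC fg) !(coefmapC fh).
exact: addr_transpose.
Qed.

(** The two sides differ by (L_f - f)(R_g - g) theta + (L_g - g)(R_f - f) theta, and both summands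
    vanish. *)
Lemma deformed_comp theta f g a b :
    Nijenhuis_pair theta f g -> Nijenhuis_pair theta g f ->
  deformed theta f (g a) b + deformed theta f a (g b)
    - coefmap g (deformed theta f a b) = deformed theta (f \o g) a b.
Proof.
move=> nij_fg nij_gf; rewrite /deformed nij_fg nij_gf.
rewrite [coefmap g (_ + _ - _)]raddfB /= [coefmap g (_ + _)]raddfD /= coefmap_comp.
exact: addrB_cancel.
Qed.

(** * Linear combinations of operators *)

Definition lincomb (q : R[i]) f g : A -> A := (q%:P \*: g) \+ f.

HB.instance Definition _ q f g :=
  GRing.Linear.copy (lincomb q f g) ((q%:P \*: g) \+ f).

Lemma coefmap_lincomb q f g p :
  coefmap (lincomb q f g) p = scaleC q (coefmap g p) + coefmap f p.
Proof.
by apply/malgP => n; rewrite mcoeffD mcoeff_scaleC !mcoeff_coefmap.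
Qed.

Section LinearCombination.
Variable theta : A -> A -> lpoly A.
Hypothesis theta_lprod : lambda_product theta.

(** L_f - f depends linearly on f. *)
Lemma Nijenhuis_pair_lincombl q f1 f2 g :
  Nijenhuis_pair theta f1 g -> Nijenhuis_pair theta f2 g ->
  Nijenhuis_pair theta (lincomb q f1 f2) g.
Proof.
case: theta_lprod => theta_l _ _ _ nij1 nij2 a b.
rewrite !theta_l nij1 nij2 !coefmap_lincomb [coefmap g (_ + _)]raddfD /=.
by rewrite coefmap_scaleC addrB_exchange !raddfB !raddfD.
Qed.

Lemma Nijenhuis_pair_lincombr q f g1 g2 :
  Nijenhuis_pair theta f g1 -> Nijenhuis_pair theta f g2 ->
  Nijenhuis_pair theta f (lincomb q g1 g2).
Proof.
case: theta_lprod => _ theta_r _ _ nij1 nij2 a b.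
rewrite !theta_r nij1 nij2 !coefmap_lincomb ![coefmap f (_ + _)]raddfD /=.
by rewrite !coefmap_scaleC addrB_exchange !raddfB !raddfD.
Qed.

Lemma deformed_lincomb q f g a b :
  deformed theta (lincomb q f g) a b =
  deformed theta f a b + scaleC q (deformed theta g a b).
Proof.
case: theta_lprod => theta_l theta_r _ _.
rewrite /deformed theta_l theta_r coefmap_lincomb addrB_exchange addrC.
by rewrite !raddfB !raddfD.
Qed.

End LinearCombination.

(** * Powers of a Nijenhuis operator *)

Lemma iter_is_linear k N : linear (iter k N).
Proof. by elim: k => [|k IHk] c x y //=; rewrite IHk linearP. Qed.

HB.instance Definition _ k N :=
  GRing.isLinear.Build {poly R[i]} A A *:%R (iter k N) (iter_is_linear k N).

Lemma iterC N i k : iter i N \o iter k N =1 iter k N \o iter i N.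
Proof. by move=> x; rewrite /= -!iterD addnC. Qed.

Lemma Nijenhuis_pair_iter theta N i k : Nijenhuis theta N ->
  Nijenhuis_pair theta (iter i N) (iter k N).
Proof.
move=> /Nijenhuis_pairP nijN; elim: i => [|i IHi].
  exact: Nijenhuis_pair_idl.
(* Peeling one N off the left power leaves the pair of N and N^k, settled by induction on k. *)
apply: Nijenhuis_pair_compl IHi; elim: k => [|k IHk].
  exact: Nijenhuis_pair_idr.
exact: Nijenhuis_pair_compr IHk.
Qed.

Lemma iterate_deformations theta N :
    assoc_lambda_product theta -> Nijenhuis theta N ->
  [/\ forall (i k : nat) (a b : A),
        deformed theta (iter i N) (iter k N a) b
          + deformed theta (iter i N) a (iter k N b)
          - coefmap (iter k N) (deformed theta (iter i N) a b)
        = deformed theta (iter (i + k) N) a b,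
      forall i k : nat, Nijenhuis (deformed theta (iter i N)) (iter k N),
      forall k : nat, assoc_lambda_product (deformed theta (iter k N))
    & forall k l : nat,
        compatible (deformed theta (iter k N)) (deformed theta (iter l N))].
Proof.
move=> theta_assoc nijN; have nij i k := Nijenhuis_pair_iter i k nijN.
split=> [i k a b|i k|k|k l q].
- have -> : iter (i + k) N = iter i N \o iter k N.
    by apply/funext => x; exact: iterD.
  exact: deformed_comp (nij i k) (nij k i).
- by apply/Nijenhuis_pairP/Nijenhuis_pair_deformed; [exact: iterC.. | exact: nij].
- by apply: assoc_deformed => //; apply/Nijenhuis_pairP; exact: nij.
have lprod := theta_assoc.1.
(* The pencil is the single deformation by N^k + q N^l. *)
have -> : (fun a b => deformed theta (iter k N) a b
                        + scaleC q (deformed theta (iter l N) a b)) =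
          deformed theta (lincomb q (iter k N) (iter l N)).
  by apply/funext => a; apply/funext => b; rewrite deformed_lincomb.
apply: assoc_deformed => //; apply/Nijenhuis_pairP.
(* Expanding both slots leaves four pairs of powers of N. *)
by apply: Nijenhuis_pair_lincombl => //; apply: Nijenhuis_pair_lincombr => //;
  exact: nij.
Qed.

End Conformal.

Theorem theorem5p13 (R : realType) (A : lmodType {poly R[i]})
    (theta : A -> A -> lpoly A) (N : A -> A)
    (htheta : assoc_lambda_product theta) (hN : Nijenhuis theta N) :
  [/\ forall (i k : nat) (a b : A),
        deformed theta (iter i N) (iter k N a) b
          + deformed theta (iter i N) a (iter k N b)
          - coefmap (iter k N) (deformed theta (iter i N) a b)
        = deformed theta (iter (i + k) N) a b,
      forall i k : nat, Nijenhuis (deformed theta (iter i N)) (iter k N),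
      forall k : nat, assoc_lambda_product (deformed theta (iter k N))
    & forall k l : nat,
        compatible (deformed theta (iter k N)) (deformed theta (iter l N))].
Proof.
pose linN : {linear A -> A} := HB.pack N (GRing.isLinear.Build _ _ _ _ N hN.1).
exact: (@iterate_deformations _ _ _ linN).
Qed.
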